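(* Let $B=[n]$ be the set of balls. (i) If $n$ is odd and $\mathcal{Q}\subseteq\binom{B}{3}$ is a set of non-adaptive queries with $\delta_2(\mathcal{Q})<\frac{n-2}{2}$, i.e. there is a pair of balls $x,y$ with $d_{\mathcal{Q}}(x,y)<\frac{n-2}{2}$, then $\mathcal{Q}$ cannot determine a non-minority ball. (ii) For every $n$ there exists a non-adaptive query set $\mathcal{Q}\subseteq\binom{B}{3}$ with $\delta_2(\mathcal{Q})=\lfloor n/2\rfloor+1$ that determines a non-minority ball. (iii) If $n$ is even and $\mathcal{Q}\subseteq\binom{B}{3}$ is a set of non-adaptive queries such that there exist four distinct balls $x,y,u,v$ with $d_{\mathcal{Q}}(x,u)+d_{\mathcal{Q}}(x,v)+d_{\mathcal{Q}}(y,u)+d_{\mathcal{Q}}(y,v)\le n/2-3$, then $\mathcal{Q}$ cannot determine a non-minority ball. (iv) Any non-adaptive query set $\mathcal{Q}\subseteq\binom{B}{3}$ with $\delta_2(\mathcal{Q})>\frac{5n}{6}$ determines a non-minority ball. (v) There exists a non-adaptive query set $\mathcal{Q}\subseteq\binom{B}{3}$ with $\delta_2(\mathcal{Q})=\frac{5n}{6}-3$ that does not determine a non-minority ball.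
   Context: The $n$ balls $B=[n]$ are each colored red or blue in an unknown way. A ball $b$ is a non-minority ball of $B$ if at least $n/2$ balls of $B$ have the color of $b$. A query is a triple $Q\in\binom{B}{3}$, and the answer is (the index of) a majority ball of $Q$, i.e. a ball of $Q$ whose color is shared by another ball of $Q$, chosen adversarially. A non-adaptive query set $\mathcal{Q}$ (all queries fixed in advance) determines a non-minority ball if for every coloring and every sequence of admissible answers to the queries of $\mathcal{Q}$, there is a ball that is a non-minority ball of $B$ in every coloring of $B$ consistent with those answers (i.e. in which each answer ball is a majority ball of its query). For $b\in B$, $d_{\mathcal{Q}}(b)=|\{Q\in\mathcal{Q}: b\in Q\}|$; for distinct $b_i,b_j\in B$, the co-degree is $d_{\mathcal{Q}}(b_i,b_j)=|\{Q\in\mathcal{Q}:\{b_i,b_j\}\subset Q\}|$, and $\delta_2(\mathcal{Q})$ is the minimum co-degree over all pairs of distinct balls.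
   Formalization: Part (ii) is stated for n ≥ 5, since co-degrees are at most n−2 and so δ₂ = ⌊n/2⌋+1 is impossible for n ≤ 4; part (v) is stated for every positive n divisible by 6, the only n for which 5n/6−3 can be a co-degree. *)

(* Defs.v *)
From HB Require Import structures.
From mathcomp Require Import all_boot all_order all_algebra.

Set Implicit Arguments.
Unset Strict Implicit.
Unset Printing Implicit Defensive.

Definition coloring (n : nat) := {ffun 'I_n -> bool}.

Definition non_minority (n : nat) (c : coloring n) (b : 'I_n) : bool :=
  n <= 2 * #|[set b' | c b' == c b]|.

Definition triples (n : nat) : {set {set 'I_n}} :=
  [set q : {set 'I_n} | #|q| == 3].

Definition majority_ball (n : nat) (c : coloring n) (q : {set 'I_n})
    (b : 'I_n) : bool :=
  (b \in q) && [exists b' in q, (b' != b) && (c b' == c b)].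

(* The answers are given by a function a on all sets of balls; only its values *)
(* on the queries of Q matter.                                                *)
Definition consistent (n : nat) (Q : {set {set 'I_n}})
    (a : {set 'I_n} -> 'I_n) (c : coloring n) : Prop :=
  forall q : {set 'I_n}, q \in Q -> majority_ball c q (a q).

Definition determines_non_minority (n : nat) (Q : {set {set 'I_n}}) : Prop :=
  forall (c : coloring n) (a : {set 'I_n} -> 'I_n),
    consistent Q a c ->
    exists b : 'I_n, forall c' : coloring n,
      consistent Q a c' -> non_minority c' b.

Definition codegree (n : nat) (Q : {set {set 'I_n}}) (x y : 'I_n) : nat :=
  #|[set q in Q | [set x; y] \subset q]|.

(* The default value #|Q| bounds every co-degree, so delta2 Q is the true    *)
(* minimum as soon as there are two balls (see delta2_attained below).        *)
Definition delta2 (n : nat) (Q : {set {set 'I_n}}) : nat :=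
  \big[minn/#|Q|]_(p : 'I_n * 'I_n | p.1 != p.2) codegree Q p.1 p.2.

Lemma delta2_le (n : nat) (Q : {set {set 'I_n}}) (x y : 'I_n) :
  x != y -> delta2 Q <= codegree Q x y.
Proof.
move=> xy; rewrite /delta2.
have : (x, y) \in index_enum ('I_n * 'I_n)%type by rewrite mem_index_enum.
elim: (index_enum _) => // p s IHs; rewrite inE big_cons => /orP [/eqP <-|/IHs le_s].
  by rewrite xy geq_minl.
by case: ifP => // _; apply: leq_trans le_s; apply: geq_minr.
Qed.

Lemma delta2_attained (n : nat) (Q : {set {set 'I_n}}) :
  1 < n -> exists x y : 'I_n, x != y /\ delta2 Q = codegree Q x y.
Proof.
move=> n_gt1.
have [dQ | //] : delta2 Q = #|Q| \/
    exists x y : 'I_n, x != y /\ delta2 Q = codegree Q x y.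
  rewrite /delta2; apply: (big_ind (fun m => m = #|Q| \/
    exists x y : 'I_n, x != y /\ m = codegree Q x y)); first by left.
  - by move=> m1 m2 H1 H2; rewrite /minn; case: ifP.
  - by case=> x y /= xy; right; exists x, y.
pose x := Ordinal (ltnW n_gt1); pose y := Ordinal n_gt1.
have xy : x != y by [].
exists x, y; split=> //; apply/eqP; rewrite eqn_leq delta2_le //= dQ.
by apply/subset_leq_card/subsetP => q; rewrite inE => /andP [].
Qed.

(* Main.v *)
(** An answer [b] to [{b, x, y}] only excludes colorings in which [x] and [y]
    agree and [b] differs.  The adversary wins as soon as he has a family of
    colorings in which every ball is somewhere in the strict minority, while
    every query has one ball that is a majority ball throughout the family.

    (i), (iii): split the balls into groups [A], [B], [X], [U] with [X] and [U]
    small, and use the colorings [A|BXU], [AX|BU], [AU|BX].  Only queries of type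
    [AXU] have no common majority ball; when few queries meet both [X] and [U],
    all their third balls fit into [B].

    (v): use three colorings and the six color vectors [011], [101], [110]
    ([m + 1] balls each) and [100], [010], [001] ([m - 1] balls each), [n = 6 m].
    Only a triple with the three vectors of one kind lacks a common majority ball.

    (ii), (iv): if no ball works, take a minimal family of consistent colorings
    whose majority sets [M_i] have empty intersection; it has at least three
    members.  Minimality gives [b_i] outside [M_i] and inside all other [M_j].  A
    ball of [M_i] and [M_j] forms with [b_i] and [b_j] a triple without common
    majority ball, hence a non-query, so co-degrees bound the sizes of the pairwise
    intersections, whereas [|M_1| + |M_2| + |M_3| - n] bounds their sum from below.
    For (ii) it suffices that a single pair has low co-degree. *)
Require Import Defs.
From mathcomp Require Import all_boot all_order all_algebra.
From mathcomp Require Import zify lra.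

Set Implicit Arguments.
Unset Strict Implicit.
Unset Printing Implicit Defensive.

(** * Co-degrees, triples and their majority balls *)

Definition thirds (n : nat) (Q : {set {set 'I_n}}) (x y : 'I_n) : {set 'I_n} :=
  [set z | [&& z != x, z != y & [set x; y; z] \in Q]].

Lemma card_thirds (n : nat) (Q : {set {set 'I_n}}) (x y : 'I_n) :
  Q \subset triples n -> x != y -> #|thirds Q x y| = codegree Q x y.
Proof.
move=> /subsetP QT xy; rewrite /codegree.
rewrite -(card_in_imset (f := fun z => [set x; y; z]) (D := thirds Q x y)).
  apply: eq_card => q; rewrite !inE; apply/imsetP/andP => [[z]|[qQ xyq]].
    by rewrite inE => /and3P [_ _ ?] ->; split=> //; rewrite subsetUl.
  have /eqP q3 : #|q| == 3 by have := QT _ qQ; rewrite inE.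
  have /cards1P [z qz] : #|q :\: [set x; y]| == 1.
    by rewrite cardsD (setIidPr xyq) q3 cards2 xy.
  have : z \in q :\: [set x; y] by rewrite qz set11.
  rewrite !inE negb_or => /andP [/andP [zx zy] zq].
  have qE : q = [set x; y; z] by rewrite -(setID q [set x; y]) (setIidPr xyq) qz.
  by exists z => //; rewrite inE zx zy -qE.
move=> z z'; rewrite !inE => /and3P [zx zy _] _ /setP /(_ z).
by rewrite !inE eqxx (negPf zx) (negPf zy) /= => /esym/eqP.
Qed.

Definition missing (n : nat) (Q : {set {set 'I_n}}) (x y : 'I_n) : {set 'I_n} :=
  [set z | [&& z != x, z != y & [set x; y; z] \notin Q]].

(** Turns a lower bound on a co-degree into an upper bound on the number of non-queries through the
    pair; the 2 counts [x] and [y] themselves. *)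
Lemma codegree_missing (n : nat) (Q : {set {set 'I_n}}) (x y : 'I_n) :
  Q \subset triples n -> x != y ->
  codegree Q x y + #|missing Q x y| + 2 = n.
Proof.
move=> QT xy; rewrite -card_thirds // -[RHS](card_ord n) -(cardsC [set x; y]).
rewrite cards2 xy [RHS]addnC; congr (_ + _).
rewrite -(cardsID (thirds Q x y) (~: [set x; y])).
congr (_ + _); apply: eq_card => z;
  by rewrite !inE negb_or; case: (z == x) => //=; case: (z == y) => //=; rewrite ?andbT.
Qed.

Lemma triple_set3 (n : nat) (q : {set 'I_n}) : q \in triples n ->
  exists x y z, [/\ x != y, x != z, y != z & q = [set x; y; z]].
Proof.
rewrite inE => /eqP q3.
have /card_gt0P [x xq] : 0 < #|q| by rewrite q3.
have /cards2P [y [z [yz qE]]] : #|q :\ x| == 2.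
  by have := cardsD1 x q; rewrite xq q3 add1n => -[<-].
have : y \in q :\ x by rewrite qE set21.
have : z \in q :\ x by rewrite qE set22.
rewrite !inE => /andP [zx _] /andP [yx _].
exists x, y, z; rewrite eq_sym yx eq_sym zx yz; split=> //.
by rewrite -setUA -qE setD1K.
Qed.

Lemma set3_triple (n : nat) (x y z : 'I_n) :
  x != y -> x != z -> y != z -> [set x; y; z] \in triples n.
Proof.
move=> xy xz yz; rewrite inE setUC cardsU1 cards2 xy !inE negb_or.
by rewrite !(eq_sym z) xz yz.
Qed.

Lemma majority_set3_1 n (c : coloring n) x y z :
  x != y -> x != z ->
  majority_ball c [set x; y; z] x = (c x == c y) || (c x == c z).
Proof.
move=> xy xz.
rewrite /majority_ball !inE eqxx /=; apply/existsP/orP => [[b]|[]].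
- rewrite !inE => /and3P [/orP [/orP []|] /eqP -> bx /eqP cb].
  + by rewrite eqxx in bx.
  + by left; rewrite cb.
  + by right; rewrite cb.
- by move/eqP=> ->; exists y; rewrite !inE !eqxx orbT /= (eq_sym y) xy.
- by move/eqP=> ->; exists z; rewrite !inE !eqxx orbT (eq_sym z) xz.
Qed.

Lemma majority_set3_2 n (c : coloring n) x y z :
  x != y -> x != z -> y != z ->
  majority_ball c [set x; y; z] y = (c y == c x) || (c y == c z).
Proof.
by move=> xy xz yz; rewrite (setUC [set x]) majority_set3_1 // eq_sym.
Qed.

Lemma majority_set3_3 n (c : coloring n) x y z :
  x != y -> x != z -> y != z ->
  majority_ball c [set x; y; z] z = (c z == c x) || (c z == c y).
Proof.
by move=> xy xz yz; rewrite setUC setUA majority_set3_1 // eq_sym.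
Qed.

(** * Adversary strategies from families of colorings *)

(** Answering each query with its common majority ball keeps the whole family consistent, so every
    ball fails in some consistent coloring. The index [i0] supplies the initial coloring that
    determination quantifies over. *)
Lemma adversary n (Q : {set {set 'I_n}}) (I : Type) (i0 : I)
    (c : I -> coloring n) :
  0 < n ->
  (forall q, q \in Q -> exists b, forall i, majority_ball (c i) q b) ->
  (forall b, exists i, ~~ non_minority (c i) b) ->
  ~ determines_non_minority Q.
Proof.
move=> n_gt0 ans minor det.
have [a aP] : exists a : {set 'I_n} -> 'I_n,
    forall q, q \in Q -> forall i, majority_ball (c i) q (a q).
  apply: (fin_all_exists (P := fun q b => q \in Q ->
    forall i, majority_ball (c i) q b)) => q.
  have [qQ|] := boolP (q \in Q); last by exists (Ordinal n_gt0).
  by have [b bP] := ans q qQ; exists b.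
have cons i : consistent Q a (c i) by move=> q qQ; apply: aP.
have [b bP] := det _ _ (cons i0).
by have [i /negP] := minor b; apply; apply: bP.
Qed.

(** * A co-degree condition that suffices for determination *)

Lemma minority_neq_color n (c : coloring n) x y :
  ~~ non_minority c x -> non_minority c y -> (c x == c y) = false.
Proof. by rewrite /non_minority => nx ny; apply: contraNF nx => /eqP ->. Qed.

(** In a tie every ball is non-minority; otherwise the non-minority balls are exactly the larger
    color class. *)
Lemma card_non_minority n (c : coloring n) : 0 < n ->
  n./2 < #|[set b | non_minority c b]|.
Proof.
move=> n_gt0.
have [ally|/forallPn [y ny]] := boolP [forall b, non_minority c b].
  have -> : [set b | non_minority c b] = setT.
    by apply/setP => b; rewrite !inE (forallP ally).
  by rewrite cardsT card_ord; lia.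
have sub : ~: [set b | c b == c y] \subset [set b | non_minority c b].
  apply/subsetP => x; rewrite !inE => xy; rewrite /non_minority.
  have -> : [set b | c b == c x] = ~: [set b | c b == c y].
    by apply/setP => b; rewrite !inE; case: (c b) (c x) (c y) xy => [] [] [].
  by have := cardsC [set b | c b == c y]; rewrite card_ord;
    move: ny; rewrite /non_minority; lia.
have := subset_leq_card sub; have := cardsC [set b | c b == c y].
by rewrite card_ord; move: ny; rewrite /non_minority; lia.
Qed.

(** Inclusion-exclusion with the triple intersection dropped. *)
Lemma leq_card_setU3 (T : finType) (A B C : {set T}) :
  #|A| + #|B| + #|C| <= #|T| + #|A :&: B| + #|A :&: C| + #|B :&: C|.
Proof.
have := cardsUI A B; have := cardsUI (A :|: B) C; rewrite setIUl.
have [+ _] := leq_card_setU (A :&: C) (B :&: C).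
have : #|A :|: B :|: C| <= #|T| := max_card _.
by lia.
Qed.

(** Each |M_i| is at least [n./2 + 1], and |M_i ∩ M_j| is at most [n - 2] minus the co-degree of b_i
    and b_j. Inserted into the bound on |M_1| + |M_2| + |M_3|, this contradicts the hypothesis,
    whose constant 9 is 3 · 1 + 3 · 2. *)
Lemma determines_of_codegree n (Q : {set {set 'I_n}}) :
  Q \subset triples n ->
  (forall x y z, x != y -> x != z -> y != z ->
     4 * n < 3 * (n./2).+3 + codegree Q x y + codegree Q x z + codegree Q y z) ->
  determines_non_minority Q.
Proof.
move=> QT degQ c a _.
have n_gt0 : 0 < n by case: (n) (a set0) => [[]|].
pose consb := [set c' | [forall q in Q, majority_ball c' q (a q)]].
pose M (c' : coloring n) := [set b | non_minority c' b].
pose empty (F : {set coloring n}) :=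
  (F \subset consb) && (\bigcap_(c' in F) M c' == set0).
case: (set_0Vmem (\bigcap_(c' in consb) M c')) => [cap0|[b /bigcapP bP]]; last first.
  exists b => c' cc'; have := bP c'; rewrite !inE; apply.
  by apply/'forall_implyP.
have [F /minsetP [/andP [Fcons /eqP F0] Fmin] _] :
    {F | minset empty F & F \subset consb}.
  by apply: minset_exists; rewrite /empty subxx cap0 eqxx.
have FP c' q : c' \in F -> q \in Q -> majority_ball c' q (a q).
  by move/(subsetP Fcons); rewrite inE => /'forall_implyP; apply.
have out b : exists2 c', c' \in F & b \notin M c'.
  have : b \notin \bigcap_(c' in F) M c' by rewrite F0 inE.
  by move/bigcapP => nb; apply/exists_inP; apply: contra_notT nb => /exists_inPn
    nb c' /nb; rewrite negbK.
have wit c' : c' \in F -> exists b, b \notin M c' /\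
    forall c'', c'' \in F -> c'' != c' -> b \in M c''.
  move=> c'F; case: (set_0Vmem (\bigcap_(d in F :\ c') M d)) => [e|[b /bigcapP bP]].
    have /Fmin : empty (F :\ c').
      by rewrite /empty e eqxx (subset_trans (subD1set _ _)).
    by move/(_ (subD1set _ _))/setP/(_ c'); rewrite !inE eqxx c'F.
  have bM d : d \in F -> d != c' -> b \in M d.
    by move=> dF dc; apply: bP; rewrite !inE dc.
  exists b; split=> //; have [d dF bd] := out b.
  by have [<- //|dc] := eqVneq d c'; rewrite bM in bd.
have big c' : n./2 < #|M c'| by apply: card_non_minority.
have pair c1 c2 b1 b2 : c1 \in F -> c2 \in F -> c1 != c2 ->
    b1 \notin M c1 -> (forall d, d \in F -> d != c1 -> b1 \in M d) ->
    b2 \notin M c2 -> (forall d, d \in F -> d != c2 -> b2 \in M d) ->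
    b1 != b2 /\ #|M c1 :&: M c2| + codegree Q b1 b2 + 2 <= n.
  move=> c1F c2F c12 b1c1 b1M b2c2 b2M.
  have b12 : b1 != b2 by apply: contraNneq b1c1 => ->; apply: b2M.
  split=> //; suff : #|M c1 :&: M c2| <= #|missing Q b1 b2|.
    by have := codegree_missing QT b12; lia.
  apply/subset_leq_card/subsetP => r; rewrite !inE => /andP [r1 r2].
  have [d dF rd] := out r.
  have dc1 : d != c1 by apply: contraNneq rd => ->; rewrite inE.
  have dc2 : d != c2 by apply: contraNneq rd => ->; rewrite inE.
  have nmE e x : (x \in M e) = non_minority e x by rewrite inE.
  have b1r : b1 != r by apply: contraNneq b1c1 => ->; rewrite nmE.
  have b2r : b2 != r by apply: contraNneq b2c2 => ->; rewrite nmE.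
  (* In a query {b1, b2, r} no answer is possible: [b1] is the odd one out in [c1], [b2] in [c2] and
     [r] in [d]. *)
  rewrite !(eq_sym r) b1r b2r /=; apply/negP => qQ.
  have: a [set b1; b2; r] \in [set b1; b2; r] by case/andP: (FP _ _ c1F qQ).
  have := b2M _ c1F c12; have := b1M _ c2F; rewrite eq_sym => /(_ c12).
  have := b1M _ dF dc1; have := b2M _ dF dc2.
  move: b1c1 b2c2 rd; rewrite !nmE => m1 m2 m3 m4 m5 m6 m7.
  rewrite !inE => /orP [/orP []|] /eqP aE.
  - by have := FP _ _ c1F qQ; rewrite aE majority_set3_1 // !minority_neq_color.
  - by have := FP _ _ c2F qQ; rewrite aE majority_set3_2 // !minority_neq_color.
  - by have := FP _ _ dF qQ; rewrite aE majority_set3_3 // !minority_neq_color.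
(* Three distinct members of [F]: [c2] omits a ball of [M c1], and [c3] omits a ball of
   [M c1 :&: M c2], which is nonempty because both sets exceed half of the balls. *)
have [c1 c1F _] := out (Ordinal n_gt0).
have /card_gt0P [x1 x1M] : 0 < #|M c1| by apply: leq_ltn_trans (big c1).
have [c2 c2F x1c2] := out x1.
have c12 : c1 != c2 by apply: contraNneq x1c2 => <-.
have /card_gt0P [x2] : 0 < #|M c1 :&: M c2|.
  have := cardsUI (M c1) (M c2); have : #|M c1 :|: M c2| <= #|'I_n| := max_card _.
  by rewrite card_ord; have := big c1; have := big c2; lia.
rewrite inE => /andP [x2c1 x2c2]; have [c3 c3F x2c3] := out x2.
have c13 : c1 != c3 by apply: contraNneq x2c3 => <-.
have c23 : c2 != c3 by apply: contraNneq x2c3 => <-.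
have [b1 [b1c b1M]] := wit _ c1F.
have [b2 [b2c b2M]] := wit _ c2F.
have [b3 [b3c b3M]] := wit _ c3F.
have [b12 d12] := pair _ _ _ _ c1F c2F c12 b1c b1M b2c b2M.
have [b13 d13] := pair _ _ _ _ c1F c3F c13 b1c b1M b3c b3M.
have [b23 d23] := pair _ _ _ _ c2F c3F c23 b2c b2M b3c b3M.
move: d12 d13 d23 (degQ _ _ _ b12 b13 b23) (leq_card_setU3 (M c1) (M c2) (M c3)).
rewrite card_ord; move: (big c1) (big c2) (big c3).
move: #|M c1 :&: M c2| #|M c1 :&: M c3| #|M c2 :&: M c3| #|M c1| #|M c2| #|M c3|.
move: (codegree Q b1 b2) (codegree Q b1 b3) (codegree Q b2 b3).
by clear; lia.
Qed.

Lemma delta2_geq n (Q : {set {set 'I_n}}) k : 1 < n ->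
  (forall x y, x != y -> k <= codegree Q x y) -> k <= delta2 Q.
Proof.
move=> n_gt1 degQ; have [x [y [xy ->]]] := delta2_attained Q n_gt1.
exact: degQ.
Qed.

(** * Switching two small groups of balls *)

Lemma exists_card_between (T : finType) (D C : {set T}) k :
  D \subset C -> #|D| <= k <= #|C| ->
  exists B : {set T}, [/\ D \subset B, B \subset C & #|B| = k].
Proof.
move=> DC /andP [Dk kC]; have : k - #|D| <= #|C :\: D|.
  by have := cardsD C D; rewrite (setIidPr DC); lia.
case/card_geqP => s [us ss sCD]; exists (D :|: [set z in s]); split.
- exact: subsetUl.
- rewrite subUset DC; apply/subsetP => z; rewrite inE => /sCD.
  by rewrite inE => /andP [].
- rewrite cardsU cardsE (card_uniqP us) ss [_ :&: _](_ : _ = set0).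
    by rewrite cards0; lia.
  apply/setP => z; rewrite !inE; apply/negP => /andP [zD /sCD].
  by rewrite inE zD.
Qed.

Lemma mem_thirds n (Q : {set {set 'I_n}}) q x y z :
  Q \subset triples n -> q \in Q -> x \in q -> y \in q -> z \in q ->
  x != y -> z != x -> z != y -> z \in thirds Q x y.
Proof.
move=> QT qQ xq yq zq xy zx zy; rewrite inE zx zy /=.
rewrite [[set _; _; _]](_ : _ = q) //; apply/eqP; rewrite eqEcard.
rewrite !subUset !sub1set xq yq zq /=.
have := subsetP QT _ qQ; rewrite inE => /eqP ->.
have := set3_triple xy (z := z); rewrite !(eq_sym _ z) inE => /(_ zx zy) /eqP -> //.
Qed.

Lemma switching_groups n (Q : {set {set 'I_n}}) (X U B : {set 'I_n}) :
  Q \subset triples n ->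
  [disjoint X & U] -> [disjoint X & B] -> [disjoint U & B] ->
  2 * #|~: (X :|: U :|: B)| < n -> 2 * #|X :|: B| < n -> 2 * #|U :|: B| < n ->
  (forall q x u z, q \in Q -> x \in q -> u \in q -> z \in q ->
     x \in X -> u \in U -> z \in X :|: U :|: B) ->
  ~ determines_non_minority Q.
Proof.
move=> QT dXU dXB dUB cA cXB cUB qB.
(* [S i] is the color class [true]. With A the complement of X ∪ U ∪ B, the index [None] gives
   A|BXU, [Some true] gives AU|BX and [Some false] gives AX|BU. *)
pose S (i : option bool) :=
  if i is Some i then (if i then X else U) :|: B else X :|: U :|: B.
pose c i : coloring n := [ffun b => b \in S i].
apply: (@adversary _ _ _ None c); first by apply: leq_ltn_trans cA.
- move=> q qQ; have := subsetP QT _ qQ => /triple_set3 [x [y [z [xy xz yz qE]]]].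
  have sub u v w : u \in q -> v \in q -> w \in q ->
    [&& u \in X, v \in U & w \notin X :|: U :|: B] = false.
    move=> uq vq wq; apply/negP => /and3P [uX vU /negP]; apply.
    exact: (qB q u v w).
  have [xq yq zq] : [/\ x \in q, y \in q & z \in q].
    by rewrite qE !inE !eqxx !orbT.
  suff : [|| [forall i, majority_ball (c i) q x],
             [forall i, majority_ball (c i) q y]
           | [forall i, majority_ball (c i) q z]].
    by case/or3P => /forallP ?; [exists x | exists y | exists z].
  have allE (P : pred (option bool)) :
      [forall i, P i] = [&& P None, P (Some true) & P (Some false)].
    by apply/forallP/and3P => [|[? ? ?] [[]|]].
  rewrite !allE qE !majority_set3_1 ?majority_set3_2 ?majority_set3_3 //.
  rewrite !ffunE !inE.
  have disj w : [/\ (w \in X) && (w \in U) = false,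
      (w \in X) && (w \in B) = false & (w \in U) && (w \in B) = false].
    by split; apply/negP => /andP [w1];
      [rewrite (disjointFr dXU) | rewrite (disjointFr dXB) | rewrite (disjointFr dUB)].
  (* The type AXU is excluded in all six orders of the balls; the remaining types are checked by
     cases on group membership. *)
  move: (sub _ _ _ xq yq zq) (sub _ _ _ xq zq yq) (sub _ _ _ yq xq zq)
    (sub _ _ _ yq zq xq) (sub _ _ _ zq xq yq) (sub _ _ _ zq yq xq).
  rewrite !inE; case: (disj x) (disj y) (disj z) => + + + [+ + +] [+ + +].
  by do 3 (case: (_ \in X); case: (_ \in U); case: (_ \in B) => //=).
(* Balls of A are in the minority for [None], those of X and B for [Some true], and those of U for
   [Some false]. *)
- move=> b; have [bA|] := boolP (b \notin X :|: U :|: B).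
    exists None; rewrite /non_minority -ltnNge; apply: leq_ltn_trans cA.
    rewrite leq_mul2l; apply/subset_leq_card/subsetP => d.
    by rewrite !inE !ffunE (negPf bA) => /eqP /=; rewrite !inE => ->.
  rewrite negbK !inE => bS.
  have [bXB|nbXB] := boolP (b \in X :|: B).
    exists (Some true); rewrite /non_minority -ltnNge; apply: leq_ltn_trans cXB.
    rewrite leq_mul2l; apply/subset_leq_card/subsetP => d.
    by rewrite inE !ffunE /= bXB => /eqP.
  exists (Some false); rewrite /non_minority -ltnNge; apply: leq_ltn_trans cUB.
  rewrite leq_mul2l; apply/subset_leq_card/subsetP => d; rewrite inE !ffunE /=.
  have -> : b \in U :|: B by move: bS nbXB; rewrite !inE; do 3 case: (b \in _).
  by move/eqP.
Qed.

Lemma leq_card_bigcup (T I : finType) (P : pred I) (F : I -> {set T}) (f : I -> nat) :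
  (forall i, P i -> #|F i| <= f i) ->
  #|\bigcup_(i | P i) F i| <= \sum_(i | P i) f i.
Proof.
move=> Ff; apply: (big_rec2 (fun (A : {set T}) t => #|A| <= t)); first by rewrite cards0.
move=> i A t Pi At; have [le _] := leq_card_setU (F i) A.
by apply: leq_trans le _; apply: leq_add => //; apply: Ff.
Qed.

(** Here [k] is the size of B. The first bound on [n] makes X ∪ B and U ∪ B strict minorities, the
    second does so for the rest A. The co-degree sum ensures that B has room for [D], the third
    balls of queries meeting both X and U. *)
Lemma light_groups n (Q : {set {set 'I_n}}) (X U : {set 'I_n}) k s :
  Q \subset triples n -> [disjoint X & U] -> #|X| = s -> #|U| = s ->
  2 * (k + s) < n < 2 * (k + 2 * s) ->
  \sum_(x in X) \sum_(u in U) codegree Q x u <= k ->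
  ~ determines_non_minority Q.
Proof.
move=> QT dXU cX cU /andP [n_gt n_lt] sumk.
pose D := (\bigcup_(x in X) \bigcup_(u in U) thirds Q x u) :\: (X :|: U).
have cXU : #|X :|: U| = 2 * s.
  by have := cardsUI X U; rewrite (disjoint_setI0 dXU) cards0; lia.
have [||B [DB BC cB]] := @exists_card_between _ D (~: (X :|: U)) k.
- by rewrite /D setDE subsetIr.
- apply/andP; split; last by have := cardsC (X :|: U); rewrite card_ord; lia.
  apply: leq_trans sumk; apply: leq_trans (subset_leq_card (subsetDl _ _)) _.
  apply: leq_card_bigcup => x xX; apply: leq_card_bigcup => u uU; rewrite card_thirds //.
  by apply: contraTneq xX => ->; rewrite (disjointFl dXU).
have dB : [disjoint X :|: U & B] by rewrite disjoint_sym disjoints_subset.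
have dXB : [disjoint X & B] := disjointWl (subsetUl _ _) dB.
have dUB : [disjoint U & B] := disjointWl (subsetUr _ _) dB.
apply: (@switching_groups _ Q X U B) => //.
- have := cardsC (X :|: U :|: B); rewrite card_ord.
  have := cardsUI (X :|: U) B.
  by rewrite (disjoint_setI0 dB) cards0; lia.
- by have [+ _] := leq_card_setU X B; lia.
- by have [+ _] := leq_card_setU U B; lia.
move=> q x u z qQ xq uq zq xX uU; rewrite inE; case: (boolP (z \in X :|: U)) => //= zXU.
apply: (subsetP DB); rewrite inE zXU; apply/bigcupP; exists x => //.
apply/bigcupP; exists u => //; apply: mem_thirds qQ _ _ _ _ _ _ => //.
- by apply: contraTneq xX => ->; rewrite (disjointFl dXU).
- by apply: contraNneq zXU => ->; rewrite inE xX.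
- by apply: contraNneq zXU => ->; rewrite inE uU orbT.
Qed.

(** * A query set with a single pair of low co-degree *)

(** All triples are asked, except that a query through [x] and [y] must have its third ball in [W].
    The bound [5 <= n] lets [W] fit outside {x, y}. *)
Lemma exists_light_pair n : 5 <= n ->
  exists Q : {set {set 'I_n}},
    [/\ Q \subset triples n, delta2 Q = (n %/ 2).+1 & determines_non_minority Q].
Proof.
move=> n_ge5; have n_gt1 : 1 < n by lia.
pose x := Ordinal (ltnW n_gt1); pose y := Ordinal n_gt1.
have xy : x != y by [].
have cxy : #|~: [set x; y]| = n - 2.
  by have := cardsC [set x; y]; rewrite cards2 xy card_ord; lia.
have [||W [_ WC cW]] := @exists_card_between _ set0 (~: [set x; y]) (n %/ 2).+1.
- exact: sub0set.
- by rewrite cards0 cxy; lia.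
pose Q := [set q in triples n | ([set x; y] \subset q) ==> (q :&: W != set0)].
have QT : Q \subset triples n by apply/subsetP => q; rewrite inE => /andP [].
have dxy : codegree Q x y = (n %/ 2).+1.
  rewrite -card_thirds // -cW; apply: eq_card => z; rewrite !inE.
  have [zW|zW] := boolP (z \in W).
    have := subsetP WC _ zW; rewrite !inE negb_or => /andP [zx zy].
    have := set3_triple xy (z := z); rewrite !(eq_sym _ z) zx zy => /(_ isT isT).
    rewrite inE => -> /=; apply/implyP => _; apply/set0Pn; exists z.
    by rewrite !inE eqxx orbT.
  apply/negP => /and4P [_ _ _ /implyP]; rewrite subsetUl => /(_ isT).
  case/set0Pn => w; rewrite !inE => /andP [/orP [wxy|/eqP -> ]]; last by rewrite (negPf zW).
  by move/(subsetP WC); rewrite !inE wxy.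
(* A non-query contains both [x] and [y], so a pair containing just one of them can only miss the
   other as third ball. *)
have dother p q : p != q -> [set p; q] != [set x; y] -> n - 3 <= codegree Q p q.
  move=> pq pqxy; pose s := if x \in [set p; q] then y else x.
  suff : #|missing Q p q| <= 1 by have := codegree_missing QT pq; lia.
  rewrite -(cards1 s); apply/subset_leq_card/subsetP => z.
  rewrite [_ \in missing _ _ _]inE => /and3P [zp zq].
  have := set3_triple pq (z := z); rewrite !(eq_sym _ z) zp zq => /(_ isT isT) pqzT.
  rewrite inE pqzT negb_imply subUset !sub1set => /andP [/andP [xS yS] _].
  have : ~~ ((x \in [set p; q]) && (y \in [set p; q])).
    apply: contra pqxy; rewrite eq_sym eqEcard !cards2 pq xy subUset !sub1set.
    by rewrite andbT.
  rewrite /s; move: xS yS; rewrite ![_ \in _ :|: [set z]]in_setU !in_set1 !(eq_sym _ z).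
  by do 2 case: (_ \in [set p; q]) => //=.
have dmin p q : p != q -> (n %/ 2).+1 <= codegree Q p q.
  move=> pq; have [pqxy|pqxy] := eqVneq [set p; q] [set x; y].
    by rewrite /codegree pqxy -dxy.
  have := dother _ _ pq pqxy; have [n7|n7] := leqP 7 n; first by lia.
  (* For [n] equal to 5 or 6, [n - 3] is too small, but then [W] is everything outside {x, y} and
     all triples are queries. *)
  have WE : W = ~: [set x; y] by apply/eqP; rewrite eqEcard WC cxy cW; lia.
  suff /eqP : #|missing Q p q| == 0 by have := codegree_missing QT pq; lia.
  rewrite cards_eq0 -subset0; apply/subsetP => z; rewrite inE => /and3P [zp zq].
  have := set3_triple pq (z := z); rewrite !(eq_sym _ z) zp zq => /(_ isT isT).
  move: [set p; q; z] => t tT; rewrite inE tT negb_imply negbK WE -setDE setD_eq0.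
  case/andP => _ /subset_leq_card; move: tT; rewrite inE => /eqP ->.
  by rewrite cards2 xy.
exists Q; split=> //.
  by apply/eqP; rewrite eqn_leq -{1}dxy delta2_le // delta2_geq.
apply: determines_of_codegree => // p q r pq pr qr.
(* Among the three pairs in a triple at most one is the light pair, so the other two have co-degree
   at least [n - 3]. *)
have share u v w : u != v -> v != w -> [set u; v] == [set x; y] ->
    [set u; w] != [set x; y].
  move=> uv vw /eqP <-; apply/eqP => /setP /(_ v).
  by rewrite !inE eqxx orbT eq_sym (negPf uv) (negPf vw).
have := dmin _ _ pq; have := dmin _ _ pr; have := dmin _ _ qr.
have rp : r != p by rewrite eq_sym.
have rq : r != q by rewrite eq_sym.
have qp : q != p by rewrite eq_sym.
have [pqxy|/(dother _ _ pq)] := boolP ([set p; q] == [set x; y]).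
  have := dother _ _ pr (share _ _ _ pq qr pqxy).
  rewrite setUC in pqxy; have := dother _ _ qr (share _ _ _ qp pr pqxy).
  by clear -n_ge5; lia.
have [prxy|/(dother _ _ pr)] := boolP ([set p; r] == [set x; y]).
  rewrite setUC in prxy.
  have := share _ _ _ rp pq prxy; rewrite setUC => /(dother _ _ qr).
  by clear -n_ge5; lia.
by clear -n_ge5; lia.
Qed.

(** * The construction with six color vectors *)

Lemma card_ord_lt N t : t <= N -> #|[set z : 'I_N | z < t]| = t.
Proof.
move=> tN; rewrite -sum1dep_card -(big_ord_widen_cond N xpredT (fun=> 1)) //.
by rewrite sum1_card card_ord.
Qed.

Lemma card_ord_mod3 N t k : k < 3 -> 3 * t <= N ->
  #|[set z : 'I_N | (z %% 3 == k) && (z < 3 * t)]| = t.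
Proof.
move=> k3 tN; rewrite -sum1dep_card.
rewrite -(big_ord_widen_cond N (fun z => z %% 3 == k) (fun=> 1)) //.
elim: t {tN} => [|t IHt]; first by rewrite big_ord0.
rewrite (_ : 3 * t.+1 = (3 * t).+3); last by lia.
rewrite big_mkcond /= !big_ord_recr /= -big_mkcond /= IHt.
have -> : 3 * t %% 3 = 0 by lia.
have -> : (3 * t).+1 %% 3 = 1 by lia.
have -> : (3 * t).+2 %% 3 = 2 by lia.
by case: k k3 {IHt} => [|[|[|]]] //= _; lia.
Qed.

(* Coordinate [i] of the color vector of a ball of residue [r] modulo 3: a low ball
   has its only 0, any other ball its only 1, in coordinate [r]. *)
Definition hue (low : bool) (r i : nat) : bool := if low then r != i else r == i.

(** Each disjunct says that one of the balls agrees with another in every coordinate. The proof is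
    an exhaustive check of the 6 · 6 · 6 choices of vectors. *)
Lemma hue_common_majority (l1 l2 l3 : bool) (r1 r2 r3 : nat) :
  r1 < 3 -> r2 < 3 -> r3 < 3 ->
  let h1 := hue l1 r1 in let h2 := hue l2 r2 in let h3 := hue l3 r3 in
  [|| all (fun i => (h1 i == h2 i) || (h1 i == h3 i)) (iota 0 3),
      all (fun i => (h2 i == h1 i) || (h2 i == h3 i)) (iota 0 3)
    | all (fun i => (h3 i == h1 i) || (h3 i == h2 i)) (iota 0 3)]
  = ~~ [&& l1 == l2, l1 == l3, r1 != r2, r1 != r3 & r2 != r3].
Proof.
by case: r1 => [|[|[|]]] // _; case: r2 => [|[|[|]]] // _;
  case: r3 => [|[|[|]]] // _; case: l1 l2 l3 => [] [] [].
Qed.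

Lemma exists_six_blocks m n : 0 < m -> n = 6 * m ->
  exists Q : {set {set 'I_n}},
    [/\ Q \subset triples n, delta2 Q = 5 * m - 3 & ~ determines_non_minority Q].
Proof.
move=> m_gt0 nE; have n_gt1 : 1 < n by lia.
(* Low balls are those below [3 * m.+1], which gives [m + 1] low and [m - 1] other balls per
   residue. The queries are all triples with a common majority ball. *)
have mod3 k : k %% 3 < 3 by rewrite ltn_mod.
pose c i : coloring n := [ffun z : 'I_n => hue (z < 3 * m.+1) (z %% 3) i].
pose good q b := all (fun i => majority_ball (c i) q b) (iota 0 3).
pose Q := [set q in triples n | [exists b in q, good q b]].
have QT : Q \subset triples n by apply/subsetP => q; rewrite inE => /andP [].
have QE (x y z : 'I_n) : x != y -> x != z -> y != z ->
    ([set x; y; z] \in Q) = ~~ [&& (x < 3 * m.+1) == (y < 3 * m.+1),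
      (x < 3 * m.+1) == (z < 3 * m.+1), x %% 3 != y %% 3, x %% 3 != z %% 3
      & y %% 3 != z %% 3].
  move=> xy xz yz; rewrite inE set3_triple //= -hue_common_majority //.
  have -> : [exists b in [set x; y; z], good [set x; y; z] b] =
      [|| good [set x; y; z] x, good [set x; y; z] y | good [set x; y; z] z].
    apply/exists_inP/or3P => [[b]|[] gb].
    - by rewrite !inE => /orP [/orP []|] /eqP ->;
        [constructor 1 | constructor 2 | constructor 3].
    - by exists x; rewrite // !inE eqxx.
    - by exists y; rewrite // !inE eqxx orbT.
    - by exists z; rewrite // !inE eqxx orbT.
  by rewrite /good; congr [|| _, _ | _]; apply: eq_all => i;
    rewrite ?majority_set3_1 ?majority_set3_2 ?majority_set3_3 // !ffunE.
have cE i : i < 3 -> #|[set z : 'I_n | (z %% 3 == i) && (z < 3 * m.+1)]| = m.+1.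
  by move=> i3; rewrite card_ord_mod3 //; lia.
have cT i : i < 3 -> #|[set z : 'I_n | z %% 3 == i]| = 2 * m.
  move=> i3; rewrite -(@card_ord_mod3 n (2 * m) i) //; last by lia.
  apply: eq_card => z; rewrite !inE; case: (_ == _) => //=.
  by apply/esym; have := ltn_ord z; lia.
have cL : #|[set z : 'I_n | z < 3 * m.+1]| = 3 * m.+1.
  by rewrite card_ord_lt //; lia.
(* Color [false] in coordinate [i] has [m + 1] low balls and [2 * (m - 1)] others, one less than
   half of [6 * m]. *)
have minor i b : i < 3 -> ~~ c i b -> ~~ non_minority (c i) b.
  move=> i3 cb; rewrite /non_minority -ltnNge.
  pose E := [set z : 'I_n | z %% 3 == i]; pose L := [set z : 'I_n | z < 3 * m.+1].
  have sub : [set z | c i z == c i b] \subset (E :&: L) :|: ~: (E :|: L).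
    apply/subsetP => z; rewrite !inE (negPf cb) ffunE /hue.
    by case: (z < _); case: (_ == i).
  have := subset_leq_card sub; have [+ _] := leq_card_setU (E :&: L) (~: (E :|: L)).
  have := cardsC (E :|: L); have := cardsUI E L; rewrite cL cT // card_ord.
  have -> : #|E :&: L| = m.+1 by rewrite -(cE i) //; apply: eq_card => z; rewrite !inE.
  by move: #|_ :|: _|; clear -nE m_gt0; lia.
have dmin (x y : 'I_n) : x != y -> 5 * m - 3 <= codegree Q x y.
  move=> xy; suff : #|missing Q x y| <= m.+1.
    by have := codegree_missing QT xy; clear -nE m_gt0; lia.
  (* The third residue: three distinct residues sum to 0 modulo 3, and the 6 keeps the subtraction
     from truncating. *)
  pose k := (6 - x %% 3 - y %% 3) %% 3; have k3 : k < 3 := mod3 _.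
  pose E := [set z : 'I_n | z %% 3 == k]; pose L := [set z : 'I_n | z < 3 * m.+1].
  have EL : #|E :&: L| = m.+1 by rewrite -(cE k) //; apply: eq_card => z; rewrite !inE.
  have sub : missing Q x y \subset if x < 3 * m.+1 then E :&: L else E :\: L.
    apply/subsetP => z; rewrite inE !(eq_sym z) => /and3P [xz yz].
    rewrite QE // negbK.
    case/and5P => _ /eqP zL xy3 xz3 yz3.
    have zk : z %% 3 == k.
      move: (mod3 x) (mod3 y) (mod3 z) xy3 xz3 yz3; rewrite /k.
      by move: (x %% 3) (y %% 3) (z %% 3); clear; lia.
    by rewrite zL; case: ifP => zL'; rewrite !inE zk zL'.
  apply: leq_trans (subset_leq_card sub) _; case: ifP => _; first by rewrite EL.
  by have := cardsID L E; rewrite EL cT //; move: #|_ :\: _|; clear; lia.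
(* The balls 0 and 1 are both low with distinct residues, so all [m + 1] low balls of residue 2 are
   missing and the minimum is attained. *)
pose x := Ordinal (ltnW n_gt1); pose y := Ordinal n_gt1.
have xy : x != y by [].
exists Q; split=> //.
  apply/eqP; rewrite eqn_leq delta2_geq // andbT.
  apply: leq_trans (delta2_le Q xy) _.
  suff : m.+1 <= #|missing Q x y|.
    by have := codegree_missing QT xy; clear -nE m_gt0; lia.
  rewrite -(cE 2) //; apply/subset_leq_card/subsetP => z.
  rewrite inE => /andP [/eqP z2 zL].
  have xz : x != z by apply: contra_eqN z2 => /eqP <-.
  have yz : y != z by apply: contra_eqN z2 => /eqP <-.
  by rewrite inE !(eq_sym z) xz yz QE //= zL z2 /=; clear -m_gt0; lia.
apply: (@adversary _ _ _ ord0 (fun i : 'I_3 => c i)); first exact: ltnW.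
  move=> q; rewrite inE => /andP [_ /exists_inP [b _ /allP gb]]; exists b => i.
  by apply: gb; rewrite mem_iota /=.
(* A coordinate where [b] has color [false]: its own residue if [b] is low, the next residue
   otherwise. *)
move=> b; have [bL|bL] := boolP (b < 3 * m.+1).
  by exists (Ordinal (mod3 b)); apply: minor => //; rewrite ffunE bL /= eqxx.
exists (Ordinal (mod3 b.+1)); apply: minor => //=; rewrite ffunE (negPf bL) /=.
by clear; lia.
Qed.

(** * The five claims *)

Theorem theorem3 (n : nat) :
  [/\ (forall Q : {set {set 'I_n}}, odd n -> Q \subset triples n ->
         ((delta2 Q)%:R < (n%:R - 2) / 2 :> rat)%R ->
         ~ determines_non_minority Q),
      (5 <= n ->
         exists Q : {set {set 'I_n}},
           [/\ Q \subset triples n, delta2 Q = (n %/ 2).+1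
             & determines_non_minority Q]),
      (forall Q : {set {set 'I_n}}, ~~ odd n -> Q \subset triples n ->
         (exists x y u v : 'I_n,
            uniq [:: x; y; u; v] /\
            ((codegree Q x u + codegree Q x v + codegree Q y u
                + codegree Q y v)%N%:R <= n%:R / 2 - 3 :> rat)%R) ->
         ~ determines_non_minority Q),
      (forall Q : {set {set 'I_n}}, Q \subset triples n ->
         (5 * n%:R / 6 < (delta2 Q)%:R :> rat)%R ->
         determines_non_minority Q)
    & (0 < n -> 6 %| n ->
         exists Q : {set {set 'I_n}},
           [/\ Q \subset triples n,
               ((delta2 Q)%:R = 5 * n%:R / 6 - 3 :> rat)%R
             & ~ determines_non_minority Q])].
Proof.
split.
- move=> Q n_odd QT dQ.
  have {}dQ : 2 * delta2 Q + 2 < n.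
    by rewrite -(Num.Theory.ltr_nat rat) GRing.natrD GRing.natrM; lra.
  have n_gt1 : 1 < n by lia.
  have [x [y [xy dE]]] := delta2_attained Q n_gt1; rewrite dE in dQ.
  (* With [n = 2h + 1] and B of size [h - 1], both X ∪ B and A have [h] balls. *)
  apply: (@light_groups _ Q [set x] [set y] (n./2 - 1) 1) => //; rewrite ?cards1 //.
  + by rewrite disjoints1 inE.
  + by clear dE; lia.
  + by rewrite !big_set1; clear dE; lia.
- exact: exists_light_pair.
- move=> Q n_even QT [x [y [u [v [/= /and4P [xyuv yuv uv _] dQ]]]]].
  set d := (codegree Q x u + _ + _ + _) in dQ.
  have {}dQ : 2 * d + 6 <= n.
    by rewrite -(Num.Theory.ler_nat rat) GRing.natrD GRing.natrM; lra.
  move: xyuv yuv uv; rewrite !inE !negb_or => /and3P [xy xu xv] /andP [yu yv] uv.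
  (* With B of size [n/2 - 3], both X ∪ B and A have [n/2 - 1] balls. *)
  apply: (@light_groups _ Q [set x; y] [set u; v] (n./2 - 3) 2) => //.
  + by rewrite disjoints_subset subUset !sub1set !inE !negb_or xu xv yu yv.
  + by rewrite cards2 xy.
  + by rewrite cards2 uv.
  + by clear -dQ n_even; lia.
  + have xNy : x \notin [set y] by rewrite inE.
    have uNv : u \notin [set v] by rewrite inE.
    rewrite (big_setU1 _ xNy) big_set1 !(big_setU1 _ uNv) !big_set1 /= addnA -/d.
    by clear -dQ n_even; lia.
- move=> Q QT dQ.
  have {}dQ : 5 * n < 6 * delta2 Q.
    by rewrite -(Num.Theory.ltr_nat rat) !GRing.natrM; lra.
  apply: determines_of_codegree => // x y z xy xz yz.
  have := delta2_le Q xy; have := delta2_le Q xz; have := delta2_le Q yz.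
  by clear -dQ; lia.
- move=> n_gt0 /dvdnP [m nE].
  have m_gt0 : 0 < m by case: m nE n_gt0 => // ->.
  have [|Q [QT dQ nQ]] := @exists_six_blocks m n m_gt0; first by rewrite nE mulnC.
  (* The truncated [5 * m - 3] is a true difference since [m] is positive. *)
  exists Q; split=> //; have : 6 * (delta2 Q + 3) = 5 * n by rewrite dQ nE; lia.
  move/(congr1 (fun k => k%:R : rat)%R); rewrite !GRing.natrM GRing.natrD; lra.
Qed.
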